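(* Suppose $X$ is a compactum and $\omega_1\leq\kappa=\min_{p\in X}\pi\chi(p,X)$. Then there is a local $\langle\kappa,\omega\rangle$-splitter at some $p\in X$.
   Context: A compactum is a compact Hausdorff space; $\pi\chi(p,X)$ is the $\pi$-character of $p$. Given cardinals $\lambda\geq\mu\geq\omega$ and a point $p$ of a space $X$, a local $\langle\lambda,\mu\rangle$-splitter at $p$ is a set $\mathcal{U}$ of $\lambda$-many open neighborhoods of $p$ such that $p$ is not contained in the interior of $\bigcap\mathcal{V}$ for any $\mathcal{V}\in[\mathcal{U}]^\mu$. *)

(* Defs.v *)
From HB Require Import structures.
From mathcomp Require Import all_boot all_order all_algebra.
From mathcomp Require Import all_classical all_reals all_analysis.
Set Implicit Arguments. Unset Strict Implicit. Unset Printing Implicit Defensive.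
Local Open Scope classical_set_scope.
Local Open Scope card_scope.

(* Cardinals are handled relationally (no cardinal type in the library):
   a cardinal is represented by a set [K : set I], compared via #<= / #=. *)

Definition local_pi_base (X : topologicalType) (p : X) (B : set (set X)) :=
  (forall b, B b -> open b /\ b !=set0) /\
  (forall U, open U -> U p -> exists2 b, B b & b `<=` U).

Definition card_le_pichar (X : topologicalType) (I : Type) (K : set I) (p : X) :=
  forall B, local_pi_base p B -> K #<= B.

Definition pichar_le_card (X : topologicalType) (I : Type) (K : set I) (p : X) :=
  exists2 B, local_pi_base p B & B #<= K.

Definition is_min_pichar (X : topologicalType) (I : Type) (K : set I) :=
  (forall p : X, card_le_pichar K p) /\ (exists p : X, pichar_le_card K p).

Definition local_splitter (X : topologicalType) (I J : Type)
    (lambda : set I) (mu : set J) (p : X) (U : set (set X)) :=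
  U #= lambda /\
  (forall u, U u -> open u /\ u p) /\
  (forall V, V `<=` U -> V #= mu -> ~ interior (\bigcap_(v in V) v) p).

(* Main.v *)
Require Import Defs.
From HB Require Import structures.
From mathcomp Require Import all_boot all_order all_algebra.
From mathcomp Require Import all_classical all_reals all_analysis.
Set Implicit Arguments. Unset Strict Implicit. Unset Printing Implicit Defensive.
Local Open Scope classical_set_scope.
Local Open Scope card_scope.

(** Following Shapirovskii, one builds [kappa] pairs of open sets with disjoint
closures that are independent: every finite choice of sides has nonempty
intersection.  Given fewer than [kappa] pairs, no point has a local pi-base
among their finite intersections (cells), so compactness yields a new pair,
independent of the old ones inside some cell.  A maximal tower of such pairs
has [kappa] members, and a Delta-system argument makes their finitely many
constraints agree.  If [kappa] is regular this is done once; if it is singular,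
it is repeated along a cofinal family of smaller cardinals, each time fixing
the sides of only finitely many earlier pairs.  Finally, let [p] be a point of
a minimal closed set meeting the closures of all cells: for each pair, remove
from the space the closure of a side that avoids [p].  Every neighbourhood of
[p] contains the trace of a cell on that closed set, and the cell constrains
only finitely many pairs, so the resulting neighbourhoods form a splitter. *)

(** * Zorn's lemma and cardinal arithmetic *)

Lemma Zorn_bigcup_above T (P : set (set T)) (R0 : set T) :
  P R0 ->
  (forall F : set (set T), F !=set0 -> F `<=` P -> total_on F subset ->
    P (\bigcup_(X in F) X)) ->
  exists A, [/\ P A, R0 `<=` A & forall B, P B -> A `<=` B -> B `<=` A].
Proof.
move=> PR0 Pchain.
(* [Zorn_bigcup] also asks for the union of the empty chain, so [set0] is adjoined. A maximal set
   equal to this extra [set0] would be exceeded by a nonempty [R0]. *)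
pose P' := [set S | S = set0 \/ (P S /\ R0 `<=` S)].
have [|A [P'A Amax]] := @Zorn_bigcup T P'.
  move=> F FP' Ftot; pose F' := F `&` [set S | P S /\ R0 `<=` S].
  have FF' : \bigcup_(X in F) X = \bigcup_(X in F') X.
    apply/seteqP; split=> x [X FX Xx]; last by exists X => //; case: FX.
    exists X => //; split => //.
    by case: (FP' _ FX) => [X0|//]; move: Xx; rewrite X0.
  have [F'0|F'0] := pselect (F' = set0).
    by left; rewrite FF' F'0 bigcup_set0.
  right; rewrite FF'; have /eqP/set0P[X F'X] := F'0; split.
    apply: Pchain; [by exists X|by move=> ? [_ []]|].
    by move=> s t [Fs _] [Ft _]; exact: Ftot.
  by move=> x R0x; exists X => //; case: F'X => _ [_]; apply.
have [PA R0A] : P A /\ R0 `<=` A.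
  case: P'A => [A0|//]; have [R00|/eqP/set0P[x R0x]] := pselect (R0 = set0).
    by rewrite A0; split; [rewrite -R00|rewrite R00].
  exfalso; apply: (Amax R0); last first.
    by right; split=> //; exact: subset_refl.
  by rewrite A0; split=> // /(_ _ R0x).
exists A; split => // B PB AB.
apply: contrapT => nBA; apply: (Amax B); first by split.
by right; split => //; exact: subset_trans AB.
Qed.

(** Finitely many members of a chain lie below the largest of them. This makes conditions on finite
    sets of pairs pass to unions of chains. *)
Lemma chain_finite_sub (T U : Type) (F : set (set T)) (f : T -> U) (E : set U) (A : set U) :
  F !=set0 -> total_on F subset -> finite_set A ->
  A `<=` E `|` f @` (\bigcup_(X in F) X) ->
  exists2 X, F X & A `<=` E `|` f @` X.
Proof.
move=> [X0 FX0] Ftot /finite_setP[n].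
elim: n A => [|n IH] A.
  by rewrite II0 card_eq0 => /eqP -> _; exists X0.
move=> /eq_cardSP[x Ax /IH{}IH] AE.
have [X FX AX] : exists2 X, F X & A `\ x `<=` E `|` f @` X.
  by apply: IH => y [/AE].
have [Ex|[z [Y FY Yz] zx]] := AE _ Ax.
  exists X => // y Ay; have [->|yx] := pselect (y = x); first by left.
  exact: AX.
have [XY|YX] := Ftot _ _ FX FY.
  exists Y => // y Ay; have [->|yx] := pselect (y = x).
    by right; exists z.
  case: (AX y) => [|Ey|[w Xw wy]]; [by []|by left|].
  by right; exists w => //; exact: XY.
exists X => // y Ay; have [->|yx] := pselect (y = x).
  by right; exists z => //; exact: YX.
exact: AX.
Qed.

Lemma card_le_funP T U (u0 : U) (A : set T) (B : set U) :
  A #<= B <-> exists2 f : T -> U, set_fun A B f & set_inj A f.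
Proof.
rewrite -injfunPex; split=> [/card_leP[f]|[f]]; last exact: inj_card_le.
by squash (valLR u0 f).
Qed.

(** With a relation in place of the injection, neither a choice of values nor an inhabitant of [U]
    has to be supplied; an empty [B] forces [A] to be empty. *)
Lemma card_le_relP T U (A : set T) (B : set U) :
  A #<= B <-> exists R : T -> U -> Prop,
    (forall a, A a -> exists2 b, B b & R a b) /\
    (forall a a' b, A a -> A a' -> R a b -> R a' b -> a = a').
Proof.
have [[u0 Bu0]|nB] := pselect (B !=set0); last first.
  have B0 : B = set0 by apply/eqP/negP => /negP/set0P.
  split=> [|[R [Rtot _]]].
    by rewrite B0 => /card_le0P ->; exists (fun _ _ => False); split.
  suff -> : A = set0 by exact: card_ge0.
  by apply/seteqP; split=> // a /Rtot[b Bb _]; apply: nB; exists b.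
split=> [/(card_le_funP u0)[f fB finj]|[R [Rtot Rinj]]].
  exists (fun a b => f a = b); split=> [a Aa|a a' b Aa Aa' <- e].
    by exists (f a) => //; exact: fB.
  by apply: finj => //; exact/mem_set.
have ex (a : T) : exists b : U, A a -> B b /\ R a b.
  have [/Rtot[b Bb Rab]|nAa] := pselect (A a); first by exists b.
  by exists u0.
have [f Hf] := choice ex; apply/(card_le_funP u0); exists f.
  by move=> a /Hf[].
move=> a a' /set_mem Aa /set_mem Aa' e; apply: (Rinj _ _ (f a)) => //.
  by case: (Hf _ Aa).
by rewrite e; case: (Hf _ Aa').
Qed.

(** A maximal graph of a partial injection is total on [A] or onto [B], since otherwise one more
    pair could be added. *)
Lemma card_le_total T U (A : set T) (B : set U) : A #<= B \/ B #<= A.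
Proof.
pose P := [set R : set (T * U) | [/\ R `<=` A `*` B,
  forall a a' b, R (a, b) -> R (a', b) -> a = a' &
  forall a b b', R (a, b) -> R (a, b') -> b = b']].
have [||R [[RAB Rinj Rfun] _ Rmax]] := @Zorn_bigcup_above _ P set0.
- by split.
- move=> F _ FP Ftot; split.
  + by move=> ab [R /FP[RAB _ _]]; exact: RAB.
  + move=> a a' b [R FR Rab] [R' FR' Rab'].
    have [RR'|RR'] := Ftot _ _ FR FR'.
      by have [_ inj _] := FP _ FR'; apply: inj Rab'; exact: RR'.
    by have [_ inj _] := FP _ FR; apply: inj Rab _; exact: RR'.
  + move=> a b b' [R FR Rab] [R' FR' Rab'].
    have [RR'|RR'] := Ftot _ _ FR FR'.
      by have [_ _ inj] := FP _ FR'; apply: inj Rab'; exact: RR'.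
    by have [_ _ inj] := FP _ FR; apply: inj Rab _; exact: RR'.
have [Adom|] := pselect (forall a, A a -> exists b, R (a, b)).
  left; apply/card_le_relP; exists (fun a b => R (a, b)); split.
    by move=> a /Adom[b Rab]; exists b => //; case/RAB: Rab.
  by move=> a a' b _ _; exact: Rinj.
move=> /existsNP[a0 /not_implyP[Aa0 na0]].
have [Bran|] := pselect (forall b, B b -> exists a, R (a, b)).
  right; apply/card_le_relP; exists (fun b a => R (a, b)); split.
    by move=> b /Bran[a Rab]; exists a => //; case/RAB: Rab.
  by move=> b b' a _ _; exact: Rfun.
move=> /existsNP[b0 /not_implyP[Bb0 nb0]].
exfalso; apply: (na0); exists b0.
apply: (Rmax (R `|` [set (a0, b0)])); [|by left|by right].
split.
- by move=> ab [/RAB//|->].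
- move=> a a' b [Rab|[? ?]] [Rab'|[? ?]]; subst => //.
  + exact: Rinj Rab Rab'.
  + by exfalso; apply: nb0; exists a.
  + by exfalso; apply: nb0; exists a'.
- move=> a b b' [Rab|[e1 e2]] [Rab'|[? ?]]; subst => //.
  + exact: Rfun Rab Rab'.
  + by exfalso; apply: na0; exists b.
  + by exfalso; apply: na0; exists b'.
Qed.

(** Hessenberg's argument: take a maximal graph of an injection of the square of some [B] inside [A]
    into [B]. If the rest of [A] embeds in [B], two disjoint copies of [B] inside [B] absorb [A];
    otherwise a copy [C] of [B] outside [B] lets the graph grow. *)
Lemma card_le_setXX T (A : set T) : infinite_set A -> A `*` A #<= A.
Proof.
move=> Ainf.
(* The side of the square is read off the diagonal, so that one relation encodes both the set and
   the map. *)
pose dg (R : set (T * T * T)) := [set x | exists z, R (x, x, z)].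
pose P := [set R : set (T * T * T) | [/\ dg R `<=` A,
  forall x y z, R (x, y, z) -> [/\ dg R x, dg R y & dg R z],
  forall x y, dg R x -> dg R y -> exists z, R (x, y, z) &
  forall x y x' y' z, R (x, y, z) -> R (x', y', z) -> x = x' /\ y = y']].
have [x0 Ax0] := infinite_setN0 Ainf.
have [n nA ninj] : exists2 n : nat -> T, set_fun setT A n & injective n.
  have /infiniteP/(card_le_funP x0)[n nA ninj] := Ainf.
  by exists n => // i j e; apply: ninj => //; exact/mem_set.
(* Starting from a pairing function on a copy of [nat] puts two distinct points, [n 0] and [n 1],
   into [B]; they tag its two disjoint copies. *)
pose R0 := [set t : T * T * T | exists i j : nat,
  t = (n i, n j, n (pickle (i, j)))].
have dg0 i : dg R0 (n i) by exists (n (pickle (i, i))), i, i.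
have [||R [[dgA RR Rtot Rinj] R0R Rmax]] := @Zorn_bigcup_above _ P R0.
- split.
  + by move=> x [z [i [j [-> _ _]]]]; exact: nA.
  + by move=> x y z [i [j [-> -> ->]]]; split.
  + move=> x y [z [i [j [-> _ _]]]] [z' [i' [j' [-> _ _]]]].
    by exists (n (pickle (i, i'))), i, i'.
  + move=> x y x' y' z [i [j [-> -> ->]]] [i' [j' [-> -> /ninj]]].
    by move=> /(pcan_inj (@pickleK (nat * nat)%type))[-> ->].
- move=> F F0 FP Ftot; split.
  + move=> x [z [R FR Rx]]; have [+ _ _ _] := FP _ FR.
    by apply; exists z.
  + move=> x y z [R FR Rx]; have [_ /(_ _ _ _ Rx)[[a ?] [b ?] [c ?]] _ _] := FP _ FR.
    by split; [exists a|exists b|exists c]; exists R.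
  + move=> x y [z [R FR Rx]] [z' [R' FR' Ry]].
    have [S [FS Sx Sy]] : exists S, [/\ F S, dg S x & dg S y].
      have [RR'|RR'] := Ftot _ _ FR FR'.
        by exists R'; split=> //; [exists z; exact: RR'|exists z'].
      by exists R; split=> //; [exists z|exists z'; exact: RR'].
    have [_ _ /(_ _ _ Sx Sy)[w Sw] _] := FP _ FS.
    by exists w, S.
  + move=> x y x' y' z [R FR Rx] [R' FR' Rx'].
    have [RR'|RR'] := Ftot _ _ FR FR'.
      by have [_ _ _ inj] := FP _ FR'; apply: inj Rx'; exact: RR'.
    by have [_ _ _ inj] := FP _ FR; apply: inj Rx _; exact: RR'.
pose B := dg R.
have nB i : B (n i) by have [z Rz] := dg0 i; exists z; exact: R0R.
have [f Hf] : exists f : T -> T -> T, forall x y, B x -> B y -> R (x, y, f x y).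
  have ex (u : T * T) : exists z, B u.1 -> B u.2 -> R (u.1, u.2, z).
    have [[Bx By]|] := pselect (B u.1 /\ B u.2).
      by have [z Rz] := Rtot _ _ Bx By; exists z.
    by move=> nB2; exists x0 => ? ?; case: nB2.
  have [f Hf] := choice ex.
  by exists (fun x y => f (x, y)) => x y; exact: (Hf (x, y)).
have fB x y : B x -> B y -> B (f x y).
  by move=> Bx By; have [] := RR _ _ _ (Hf _ _ Bx By).
have finj x y x' y' : B x -> B y -> B x' -> B y' -> f x y = f x' y' ->
    x = x' /\ y = y'.
  move=> Bx By Bx' By' e; apply: (Rinj _ _ _ _ (f x y)); first exact: Hf.
  by rewrite e; exact: Hf.
have nfB x i : B x -> B (f x (n i)) by move=> Bx; exact: fB.
have [AB|BA] := card_le_total (A `\` B) B.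
  have [e eB einj] := (card_le_funP x0 _ _).1 AB.
  pose c x := if pselect (B x) then f x (n 0%N) else f (e x) (n 1%N).
  have cB x : A x -> B (c x).
    by rewrite /c; case: pselect => Bx Ax; apply: nfB => //; apply: eB; split.
  have cinj x y : A x -> A y -> c x = c y -> x = y.
    rewrite /c => Ax Ay; case: pselect => Bx; case: pselect => By /finj[]//.
    + by apply: eB; split.
    + by move=> _ /ninj.
    + by apply: eB; split.
    + by move=> _ /ninj.
    + by apply: eB; split.
    + by apply: eB; split.
    + by move=> exy _; apply: einj => //; apply/mem_set; split.
  apply/(card_le_funP x0); exists (fun u => f (c u.1) (c u.2)).
    by move=> [x y] [/= Ax Ay]; apply/dgA/fB; exact: cB.
  move=> [x y] [x' y'] /set_mem[/= Ax Ay] /set_mem[/= Ax' Ay'].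
  move=> /finj[]; [exact: cB|exact: cB|exact: cB|exact: cB|].
  by move=> /(cinj _ _ Ax Ax') -> /(cinj _ _ Ay Ay') ->.
have [e eB einj'] := (card_le_funP x0 _ _).1 BA.
have einj x y : B x -> B y -> e x = e y -> x = y.
  by move=> Bx By; apply: einj'; exact/mem_set.
exfalso.
pose C := e @` B.
have CNB x : C x -> ~ B x by move=> [y /eB[_ nBy] <-].
have [d Hd] : exists d : T -> T, forall x, C x -> B (d x) /\ e (d x) = x.
  have ex x : exists y, C x -> B y /\ e y = x.
    have [[y By eyx]|] := pselect (C x); first by exists y.
    by exists x0.
  by have [d Hd] := choice ex; exists d.
(* [q] embeds the union of [B] and [C] into [B]. The new pairs can then take their values in [C],
   where no old value lies. *)
pose q x := if pselect (B x) then f x (n 0%N) else f (d x) (n 1%N).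
have qB x : (B `|` C) x -> B (q x).
  rewrite /q; case: pselect => Bx; first by move=> _; exact: nfB.
  by case=> // /Hd[? _]; exact: nfB.
have qinj x y : (B `|` C) x -> (B `|` C) y -> q x = q y -> x = y.
  rewrite /q; case: pselect => Bx; case: pselect => By.
  + by move=> _ _ /finj[].
  + by move=> _ [//|/Hd[Bdy _]] /finj[]// _ /ninj.
  + by move=> [//|/Hd[Bdy _]] _ /finj[]// _ /ninj.
  + move=> [//|/Hd[Bdx ex]] [//|/Hd[Bdy ey]] /finj[]// dxy _.
    by rewrite -ex -ey dxy.
pose R' := R `|` [set t : T * T * T | [/\ (B `|` C) t.1.1, (B `|` C) t.1.2,
  ~ (B t.1.1 /\ B t.1.2) & t.2 = e (f (q t.1.1) (q t.1.2))]].
have dgR' : dg R' = B `|` C.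
  apply/seteqP; split.
    by move=> x [z [Rz|[]//]]; left; exists z.
  move=> x [[z Rz]|Cx]; first by exists z; left.
  exists (e (f (q x) (q x))); right; split; [by right|by right| |by []].
  by case=> /(CNB _ Cx).
have CB : C `<=` B.
  move=> x Cx.
  have [z Rz] : dg R' x by rewrite dgR'; right.
  exists z; apply: (Rmax R') Rz; last by left.
  split.
  + rewrite dgR' => y [/dgA//|[w Bw <-]]; by case: (eB _ Bw).
  + rewrite dgR' => a b c [/RR[? ? ?]|[/= Ba Bb _ ->]]; first by split; left.
    by split => //; right; exists (f (q a) (q b)) => //; apply: fB; exact: qB.
  + rewrite dgR' => a b Ba Bb.
    have [[Ba' Bb']|nab] := pselect (B a /\ B b).
      by have [w Rw] := Rtot _ _ Ba' Bb'; exists w; left.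
    by exists (e (f (q a) (q b))); right.
  + move=> a b a' b' w [Rw|[/= Ba Bb nab we]] [Rw'|[/= Ba' Bb' nab' we']].
    * exact: Rinj Rw Rw'.
    * have [_ _ Bw] := RR _ _ _ Rw; exfalso; apply: (CNB w) => //.
      by rewrite we'; exists (f (q a') (q b')) => //; apply: fB; exact: qB.
    * have [_ _ Bw] := RR _ _ _ Rw'; exfalso; apply: (CNB w) => //.
      by rewrite we; exists (f (q a) (q b)) => //; apply: fB; exact: qB.
    * move: we'; rewrite we => /einj/finj[]; try by [apply: fB; exact: qB|exact: qB].
      by move=> /(qinj _ _ Ba Ba') -> /(qinj _ _ Bb Bb') ->.
have Cen : C (e (n 0%N)) by exists (n 0%N).
exact: (CNB _ Cen (CB _ Cen)).
Qed.

(** Smallness is kept abstract because it has two uses: embedding in a fixed infinite set and, for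
    regular [K], not being above [K]. *)
Record card_ideal (small : forall J : Type, set J -> Prop) : Prop := {
  small_le : forall (J J' : Type) (A : set J) (B : set J'),
    A #<= B -> small _ B -> small _ A;
  small_nat : small _ [set: nat];
  small_bigcup : forall (J J' : Type) (D : set J) (F : J -> set J'),
    small _ D -> (forall i, D i -> small _ (F i)) ->
    small _ (\bigcup_(i in D) F i) }.

(** A point of the union is coded by its index and its place in that piece, that is, in the square
    of [Y], which embeds in [Y]. *)
Lemma card_ideal_le (U : Type) (Y : set U) :
  infinite_set Y -> card_ideal (fun J (A : set J) => A #<= Y).
Proof.
move=> Yinf; have [u0 Yu0] := infinite_setN0 Yinf; split.
- by move=> J J' A B; exact: card_le_trans.
- exact/infiniteP.
move=> J J' D F /(card_le_funP u0)[c cY cinj] FY.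
apply: card_le_trans (card_le_setXX Yinf).
have ex j : exists g : J' -> U, D j -> set_fun (F j) Y g /\ set_inj (F j) g.
  have [Dj|] := pselect (D j); last by exists (fun=> u0).
  by have [g gY ginj] := (card_le_funP u0 _ _).1 (FY _ Dj); exists g.
have [g Hg] := choice ex.
apply/card_le_relP.
exists (fun x u => exists j, [/\ D j, F j x & u = (c j, g j x)]); split.
  move=> x [j Dj Fx]; exists (c j, g j x); last by exists j.
  by split=> /=; [exact: cY|case: (Hg _ Dj) => + _; apply].
move=> x x' u _ _ [j [Dj Fx ->]] [j' [Dj' Fx' [cjj']]].
have jj' : j = j' by apply: cinj => //; exact/mem_set.
rewrite -jj' in Fx' * => gxx'.
by case: (Hg _ Dj) => _; apply => //; exact/mem_set.
Qed.

Section card_ideal.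
Variables (small : forall J : Type, set J -> Prop) (Hsmall : card_ideal small).

Lemma small_sub J (A B : set J) : A `<=` B -> small B -> small A.
Proof. by move=> /subset_card_le; exact: small_le. Qed.

Lemma small_countable J (A : set J) : countable A -> small A.
Proof. by move=> /(small_le Hsmall); apply; exact: small_nat. Qed.

Lemma small_finite J (A : set J) : finite_set A -> small A.
Proof. by move=> /finite_set_countable; exact: small_countable. Qed.

Lemma small_setU J (A B : set J) : small A -> small B -> small (A `|` B).
Proof.
move=> sA sB; rewrite -bigcup2inE.
apply: small_bigcup => //; first exact: small_finite (finite_II 2).
by move=> [|[|]].
Qed.

Lemma small_image J J' (f : J -> J') (A : set J) : small A -> small (f @` A).
Proof. by apply: small_le => //; exact: card_image_le. Qed.

(** A set of [n.+1] points is a set of [n] points with one added, so each finite size contributes a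
    small union of small sets. *)
Lemma small_finite_subset J (D : set J) :
  small D -> small [set A | A `<=` D /\ finite_set A].
Proof.
move=> sD.
suff sn n : small [set A | A `<=` D /\ A #= `I_n].
  apply: (@small_sub _ _ (\bigcup_n [set A | A `<=` D /\ A #= `I_n])).
    by move=> A [AD /finite_setP[n An]]; exists n.
  by apply: small_bigcup => //; exact: small_nat.
elim: n => [|n IH].
  apply: (@small_sub _ _ [set set0]); last exact/small_finite/finite_set1.
  by move=> A [_]; rewrite II0 card_eq0 => /eqP.
apply: (@small_sub _ _ (\bigcup_(A in [set A | A `<=` D /\ A #= `I_n])
    ((fun x => x |` A) @` D))).
  move=> A [AD /eq_cardSP[x Ax An]]; exists (A `\ x).
    by split=> // y [/AD].
  by exists x; [exact: AD|apply: setDUK => y ->].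
by apply: small_bigcup => // A _; exact: small_image.
Qed.

Lemma small_literals J (Z : set J) : small Z -> small [set l : J * bool | Z l.1].
Proof.
move=> sZ; apply: (@small_sub _ _
    ((fun v => (v, true)) @` Z `|` (fun v => (v, false)) @` Z)).
  by move=> [v []] /= Zv; [left|right]; exists v.
by apply: small_setU => //; exact: small_image.
Qed.

End card_ideal.

(** The largest of [nat], [A] and [B] is infinite and [K] does not embed in it; the sets that embed
    in it form the ideal. This works for singular [K] as well. *)
Lemma card_nle_ideal (I J J' : Type) (K : set I) (A : set J) (B : set J') :
  ~ (K #<= [set: nat]) -> ~ (K #<= A) -> ~ (K #<= B) ->
  exists small : forall J : Type, set J -> Prop,
    [/\ card_ideal small, small _ A, small _ B & ~ small _ K].
Proof.
move=> Kn KA KB.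
suff [U [Y [nY AY BY KY]]] : exists (U : Type) (Y : set U),
    [/\ [set: nat] #<= Y, A #<= Y, B #<= Y & ~ (K #<= Y)].
  exists (fun J (A : set J) => A #<= Y); split => //.
  by apply: card_ideal_le; exact/infiniteP.
have [AB|BA] := card_le_total A B.
  have [nB|Bn] := card_le_total [set: nat] B.
    by exists J', B; split.
  by exists nat, setT; split => //; exact: card_le_trans Bn.
have [nA|An] := card_le_total [set: nat] A.
  by exists J, A; split.
by exists nat, setT; split => //; exact: card_le_trans An.
Qed.

(** * Compact Hausdorff spaces *)

Lemma compact_hausdorff_shrink (X : topologicalType) (p : X) (U : set X) :
  compact [set: X] -> hausdorff_space X -> open U -> U p ->
  exists2 V, open V /\ V p & closure V `<=` U.
Proof.
move=> cX hX oU Up.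
have [|W Wp WU] := @compact_regular X p setT hX cX filterT U.
  exact: open_nbhs_nbhs.
exists W°; first by split; [exact: open_interior|exact: Wp].
by apply: subset_trans WU; apply: closureS; exact: interior_subset.
Qed.

(* If no member of [GG] forces a suitable pair, then the complements of the
   neighbourhoods [V p] all lie in the filter of sets that densely many
   members of [GG] are included in, which then has no cluster point. *)
Lemma ex_independent_pair (X : topologicalType) (I : Type) (K : set I)
    (GG : set (set X)) :
  compact [set: X] -> hausdorff_space X -> (forall p : X, card_le_pichar K p) ->
  ~ (K #<= GG) -> GG !=set0 -> (forall D, GG D -> open D /\ D !=set0) ->
  exists D A0 A1, [/\ GG D, open A0, open A1,
    closure A0 `&` closure A1 = set0 &
    forall D', GG D' -> D' `<=` D -> D' `&` A0 !=set0 /\ D' `&` A1 !=set0].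
Proof.
move=> cX hX HK KGG [D0 GGD0] GGopen.
(* Shrinking twice keeps the closure of [V.2] inside a neighbourhood of [p] that includes no member
   of [GG], and makes the closures of [V.1] and of the complement of [closure V.2] disjoint. *)
have ex p : exists V : set X * set X, [/\ open V.1, V.1 p, open V.2,
    closure V.1 `<=` V.2 & forall D, GG D -> ~ (D `<=` closure V.2)].
  have : ~ local_pi_base p GG by move=> /HK.
  move=> /not_andP[//|/existsNP[U /not_implyP[oU /not_implyP[Up nU]]]].
  have [W [oW Wp] WU] := compact_hausdorff_shrink cX hX oU Up.
  have [V [oV Vp] VW] := compact_hausdorff_shrink cX hX oW Wp.
  exists (V, W); split => //= D GGD DW; apply: nU; exists D => //.
  exact: subset_trans WU.
have [V HV] := choice ex.
apply: contrapT => nex.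
(* Otherwise every member of [GG] below [D] meets [(V p).1]; it also leaves the closure of
   [(V p).2], so these two open sets would be the pair sought. *)
have dense p D : GG D -> exists D', [/\ GG D', D' `<=` D & D' `&` (V p).1 = set0].
  move=> GGD; apply: contrapT => nD'; apply: nex.
  have [oV1 Vp oV2 V12 nV2] := HV p.
  exists D, (V p).1, (~` closure (V p).2); split => //.
  - exact/closed_openC/closed_closure.
  - apply/eqP; rewrite setIC; apply/eqP/disjoints_subset.
    apply: (@subset_trans _ (~` (V p).2)); last exact: subsetC.
    apply: (@subset_trans _ (closure (~` (V p).2))).
      by apply/closureS/subsetC; exact: subset_closure.
    by rewrite -((closure_id _).1 (open_closedC oV2)).
  - move=> D' GGD' D'D; split.
      apply/set0P/negP => /eqP D'V; apply: nD'; by exists D'.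
    apply: contrapT => e; apply: (nV2 D') => // x D'x.
    by apply: contrapT => nx; apply: e; exists x.
pose F := [set A : set X | forall D, GG D ->
  exists D', [/\ GG D', D' `<=` D & D' `<=` A]].
have FF : ProperFilter F.
  split.
    by move=> /(_ _ GGD0)[D' [/GGopen[_ [x D'x]] _ /(_ _ D'x)]].
  split.
  - by move=> D GGD; exists D; split.
  - move=> A B FA FB D GGD; have [D1 [GGD1 D1D D1A]] := FA _ GGD.
    have [D2 [GGD2 D2D1 D2B]] := FB _ GGD1; exists D2; split => //.
      exact: subset_trans D1D.
    by move=> x D2x; split; [exact/D1A/D2D1|exact: D2B].
  - move=> A B AB FA D GGD; have [D1 [GGD1 D1D D1A]] := FA _ GGD.
    by exists D1; split => //; exact: subset_trans AB.
have [p [_ Fp]] := cX F FF filterT.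
have [oV1 Vp _ _ _] := HV p.
have [||x [/= nx]] := Fp (~` (V p).1) (V p).1; last by [].
- move=> D /(dense p)[D' [GGD' D'D /disjoints_subset D'V]].
  by exists D'.
- exact: open_nbhs_nbhs.
Qed.

(** Zorn's lemma is applied to the open complements; compactness keeps the complement of the union
    of a chain meeting each [M]. If [W] meets [C], removing it from [C] must break some condition,
    which means that a trace of some [M] lies in [W]. *)
Lemma compact_minimal_meeting (X : topologicalType) (MM : set (set X)) :
  compact [set: X] -> (forall M, MM M -> closed M /\ M !=set0) ->
  exists C, [/\ closed C, forall M, MM M -> C `&` M !=set0 &
    forall W, open W -> C `&` W !=set0 ->
      exists2 M, MM M & C `&` M `<=` W].
Proof.
move=> cX MMP.
pose P := [set D : set X | open D /\
  forall M, MM M -> ~` D `&` M !=set0].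
have [||D [[oD DM] _ Dmax]] := @Zorn_bigcup_above _ P set0.
- split; first exact: open0.
  by move=> M /MMP[_ [x Mx]]; exists x; split.
- move=> F [D0 FD0] FP Ftot; split.
    by apply: bigcup_open => D /FP[].
  move=> M MMM; have [cM _] := MMP _ MMM.
  pose G := [set A : set X | exists2 D, F D & ~` D `&` M `<=` A].
  have GF : ProperFilter G.
    split.
      move=> [D FD]; have [_ /(_ _ MMM)[x Dx]] := FP _ FD.
      by move=> /(_ _ Dx).
    split.
    - by exists D0.
    - move=> A B [D FD DA] [D' FD' DB].
      have [DD'|DD'] := Ftot _ _ FD FD'.
        exists D' => // x [D'x Mx]; split; last by apply: DB.
        by apply: DA; split => // /DD'.
      exists D => // x [D'x Mx]; split; first by apply: DA.
      by apply: DB; split => // /DD'.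
    - by move=> A B AB [D FD DA]; exists D => //; exact: subset_trans AB.
  have [p [_ Gp]] := cX G GF filterT.
  have cl D : F D -> (~` D `&` M) p.
    move=> FD; have [oD _] := FP _ FD.
    have : closed (~` D `&` M) by apply: closedI => //; exact: open_closedC.
    move=> /closure_id ->; move=> B pB.
    by apply: Gp => //; exists D.
  exists p; split; last by case: (cl _ FD0).
  by move=> [D /cl[]].
exists (~` D); split => //; first exact: open_closedC.
move=> W oW [x [nDx Wx]].
have : ~ P (D `|` W).
  move=> /Dmax DW; apply: nDx; apply: DW; [by move=> ?; left|by right].
move=> /not_andP[|/existsNP[M /not_implyP[MMM nM]]].
  by case; exact: openU.
exists M => // y [nDy My]; apply: contrapT => nWy; apply: nM; exists y.
by split => // -[].
Qed.

(** * Independent families of pairs of open sets *)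

Section dyadic.
Variables (X : topologicalType) (I : Type).

(* A pair of open sets, tagged so that one pair can be used at several indices. *)
Let V := (I * (set X * set X))%type.
Implicit Types (f g h r : set (V * bool)) (v : V) (E : set V).

Definition side (l : V * bool) : set X := if l.2 then l.1.2.2 else l.1.2.1.

Definition cell f : set X := \bigcap_(l in f) side l.

Definition supp f : set V := fst @` f.

Definition separated_pair v :=
  [/\ open v.2.1, open v.2.2 & closure v.2.1 `&` closure v.2.2 = set0].

Definition consistent f := forall v, f (v, true) -> f (v, false) -> False.

(* [h] is a partial assignment; the pairs of [E] are independent above it. *)
Record dyadic_above E h : Prop := {
  dyadic_sep : forall v, E v -> separated_pair v;
  dyadic_consistent : consistent h;
  dyadic_supp : supp h `<=` E;
  dyadic_cell : forall f, finite_set f -> supp f `<=` E ->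
    consistent (f `|` h) -> cell f !=set0 }.

Lemma separated_side_open v b : separated_pair v -> open (side (v, b)).
Proof. by case: b => -[]. Qed.

Lemma separated_sideP v b x : separated_pair v ->
  closure (side (v, b)) x -> closure (side (v, ~~ b)) x -> False.
Proof.
rewrite /side /= => -[_ _ vd].
by case: b => /= h1 h2; rewrite -[False]/(set0 x) -vd; split.
Qed.

Lemma consistent_sub f g : f `<=` g -> consistent g -> consistent f.
Proof. by move=> fg cg v /fg ? /fg ?; exact: (cg v). Qed.

Lemma consistentP f v b : consistent f -> f (v, b) -> f (v, ~~ b) -> False.
Proof. by move=> cf; case: b => ? ?; exact: (cf v). Qed.

Lemma cell_sub f g : f `<=` g -> cell g `<=` cell f.
Proof. by move=> fg x gx l /fg; exact: gx. Qed.

Lemma supp_sub f g : f `<=` g -> supp f `<=` supp g.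
Proof. exact: image_subset. Qed.

Lemma cell_open f : finite_set f -> (forall v, supp f v -> separated_pair v) ->
  open (cell f).
Proof.
move=> /finite_setP[n].
elim: n f => [|n IH] f.
  by rewrite II0 card_eq0 => /eqP -> _; rewrite /cell bigcap_set0; exact: openT.
move=> /eq_cardSP[l fl fn] fsep.
have -> : cell f = side l `&` cell (f `\ l).
  apply/seteqP; split=> x.
    by move=> fx; split; [exact: fx|apply: cell_sub fx => ? []].
  move=> [lx fx] l' fl'; have [->//|nl] := pselect (l' = l).
  exact: fx.
apply: openI.
  by case: l fl {fn} => v b fl; apply: separated_side_open; apply: fsep; exists (v, b).
by apply: IH => // v [l' [fl' _] <-]; apply: fsep; exists l'.
Qed.

(* At a point [p] of a minimal closed set [C] meeting the closure of every
   cell, each pair [v] of [F] has a side whose closure avoids [p]; removing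
   that closure gives the neighbourhood attached to [v].  A neighbourhood of
   [p] contains a trace on [C] of some cell, and this constrains only
   finitely many of the pairs. *)
Lemma dyadic_local_splitter (K : set I) (F : set V) :
  compact [set: X] -> K #<= F -> dyadic_above F set0 ->
  exists (p : X) (U : set (set X)), local_splitter K [set: nat] p U.
Proof.
(* A splitter has exactly [K] members, hence the passage to a subfamily [F0] equinumerous with
   [K]. *)
move=> cX /card_subP[F0 F0K F0F] [Fsep _ _ Fcell].
pose Q := [set f | [/\ finite_set f, supp f `<=` F0 & consistent f]].
have Qcell f : Q f -> cell f !=set0.
  move=> [ff fF0 cf]; apply: Fcell; [by []|exact: subset_trans F0F|].
  by rewrite setU0.
have [|C [cC CM Cmin]] :=
    @compact_minimal_meeting X ((closure \o cell) @` Q) cX.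
  move=> _ [f /Qcell[x fx] <-]; split; first exact: closed_closure.
  by exists x; exact: subset_closure.
have Q0 : Q set0 by split => //; rewrite /supp image_set0.
have [p [Cp _]] := CM _ (ex_intro2 _ _ set0 Q0 erefl).
have ex v : exists b, F0 v -> ~ closure (side (v, b)) p.
  have [F0v|] := pselect (F0 v); last by exists true.
  have [ptrue|] := pselect (closure (side (v, true)) p); last by exists true.
  exists false => _ pfalse.
  exact: (@separated_sideP v true p (Fsep _ (F0F _ F0v))).
have [b Hb] := choice ex.
pose U v := ~` closure (side (v, b v)).
have QU f v : Q f -> F0 v -> ~ supp f v -> Q (f `|` [set (v, b v)]).
  move=> [ff fF0 cf] F0v nfv; split.
  - by rewrite finite_setU; split.
  - by move=> _ [l [fl|->] <-//]; apply: fF0; exists l.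
  - move=> w [f1|[e1 e2]] [f2|[e3 e4]].
    + exact: (cf w).
    + by apply: nfv; exists (w, true).
    + by apply: nfv; exists (w, false).
    + by move: e4; rewrite -e3 e1 -e2.
exists p, (U @` F0); split; last split.
(* Distinct pairs give distinct neighbourhoods: a point on side [~~ b w] of [w] and on side [b v] of
   [v] lies in [U w] but not in [U v]. *)
- apply: card_eq_trans F0K; apply: inj_card_eq => v w /set_mem F0v /set_mem F0w Uvw.
  apply: contrapT => nvw.
  have Qw : Q [set (w, ~~ b w)].
    split => //; first by move=> _ [_ -> <-].
    by move=> u [_ e] [_]; rewrite -e.
  have [|x fx] := Qcell _ (QU [set (w, ~~ b w)] v Qw F0v _).
    by move=> [_ -> /esym].
  have : U w x.
    move=> /(@separated_sideP w (b w) x (Fsep _ (F0F _ F0w))); apply.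
    by apply: subset_closure; apply: fx; left.
  by rewrite -Uvw; apply; apply: subset_closure; apply: fx; right.
- move=> _ [v F0v <-]; split; last exact: Hb.
  exact/closed_openC/closed_closure.
move=> VV VVU VVn pint.
have [|_ [f Qf <-] CfW] := Cmin (\bigcap_(v in VV) v)° (open_interior _).
  by exists p.
have [v [F0v VVv nfv]] : exists v, [/\ F0 v, VV (U v) & ~ supp f v].
  apply: contrapT => nex; have [ff _ _] := Qf.
  have : finite_set VV.
    apply: (@sub_finite_set _ _ (U @` supp f)).
      move=> u VVu; have [v F0v vu] := VVU _ VVu; exists v => //.
      by apply: contrapT => nfv; apply: nex; exists v; rewrite vu.
    by do 2 apply: finite_image.
  by apply/infiniteP; move: VVn; rewrite card_eq_sym card_eq_le => /andP[].
(* Since [f] leaves [v] free, it can be extended by the very side whose closure [U v] omits; the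
   trace of this cell on [C] still lies in the interior. *)
have [x [Cx fx]] := CM _ (ex_intro2 _ _ _ (QU _ _ Qf F0v nfv) erefl).
have Wx : (\bigcap_(v in VV) v) x.
  apply: interior_subset; apply: CfW; split => //.
  by move: x fx {Cx}; apply: closureS; apply: cell_sub => l; left.
apply: (Wx _ VVv); move: x fx {Cx Wx}; apply: closureS => x fx.
by apply: fx; right.
Qed.

End dyadic.

(** * Towers of conditionally independent pairs *)

Section tower.
Variables (X : topologicalType) (I : Type) (K : set I).
Let V := (I * (set X * set X))%type.
Variables (E : set V) (h : set (V * bool)).
Implicit Types (f g : set (V * bool)) (v : V) (S : set (V * set (V * bool))).

(* [S (v, g)] means that [v] is only required to be independent of the other
   pairs inside the cell of [g]. *)
Definition admissible S f :=
  [/\ finite_set f, supp f `<=` E `|` fst @` S, consistent (f `|` h) &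
    forall v g, supp f v -> S (v, g) -> g `<=` f].

(** Injectivity and freshness concern the tags [v.1], so that they survive when the open sets of a
    pair are shrunk and its tag is kept. *)
Record tower S : Prop := {
  tower_sep : forall v g, S (v, g) -> separated_pair v;
  tower_adm : forall v g, S (v, g) -> admissible S g /\ ~ supp g v;
  tower_inj : forall v g v' g', S (v, g) -> S (v', g') -> v.1 = v'.1 ->
    v = v' /\ g = g';
  tower_fresh : forall v g, S (v, g) -> ~ (fst @` E) v.1;
  tower_cell : forall f, admissible S f -> cell f !=set0 }.

Lemma tower_set0 : dyadic_above E h -> tower set0.
Proof.
move=> [Esep hc hE Ecell]; split => // f [ff fE fc _].
by apply: Ecell => //; move: fE; rewrite image_set0 setU0.
Qed.

Lemma tower_bigcup (F : set (set (V * set (V * bool)))) :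
  F !=set0 -> F `<=` tower -> total_on F subset ->
  tower (\bigcup_(S in F) S).
Proof.
move=> F0 FP Ftot.
have inj v g v' g' : (\bigcup_(S in F) S) (v, g) ->
    (\bigcup_(S in F) S) (v', g') -> v.1 = v'.1 -> v = v' /\ g = g'.
  move=> [S FS Sv] [S' FS' Sv'].
  have [SS'|SS'] := Ftot _ _ FS FS'.
    by apply: (tower_inj (FP _ FS')) => //; exact: SS'.
  by apply: (tower_inj (FP _ FS)) => //; exact: SS'.
split => //.
- by move=> v g [S FS Sv]; exact: (tower_sep (FP _ FS) Sv).
- move=> v g [S FS Sv].
  have [[gf gE gc gS] ngv] := tower_adm (FP _ FS) Sv; split => //; split => //.
    move=> w /gE[Ew|[vg Svg <-]]; first by left.
    by right; exists vg => //; exists S.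
  (* The union of the chain attaches no new constraint to [w]: freshness keeps [w] out of [E], and
     injectivity identifies its constraint with the one in [S]. *)
  move=> w g' gw Sw; case: (gE _ gw) => [Ew|[[w' g''] Svg /= e]].
    case: (Sw) => S' FS' S'w; exfalso.
    by apply: (tower_fresh (FP _ FS') S'w); exists w.
  subst w'; have [|//|_ ->] := inj w g' w g'' Sw; first by exists S.
  exact: gS Svg.
- by move=> v g [S FS Sv]; exact: (tower_fresh (FP _ FS) Sv).
- move=> f [ff fE fc fS].
  have [|S FS fES] := @chain_finite_sub _ _ F fst E (supp f) F0 Ftot _ fE.
    exact: finite_image.
  apply: (tower_cell (FP _ FS)); split => // v g fv Sv.
  by apply: fS fv _; exists S.
Qed.

Lemma tower_extend S :
  compact [set: X] -> hausdorff_space X -> (forall p : X, card_le_pichar K p) ->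
  ~ (K #<= [set: nat]) -> (forall v, E v -> separated_pair v) -> consistent h ->
  ~ (K #<= E) -> ~ (K #<= fst @` S) -> tower S ->
  exists v g, ~ (fst @` S) v /\ tower (S `|` [set (v, g)]).
Proof.
move=> cX hX HK Kn Esep hc KE KS [Ssep Sadm Sinj Sfresh Scell].
have [small [ideal sE sS nsK]] := card_nle_ideal Kn KE KS.
have sZ : small _ (E `|` fst @` S) by exact: small_setU.
have dsep f v : admissible S f -> supp f v -> separated_pair v.
  by move=> [_ fE _ _] /fE[/Esep//|[[w g] Sw <-]]; exact: Ssep Sw.
have [|||A [B [A1 [[g adg <-] oA0 oA1 A01 gind]]]] :=
    @ex_independent_pair X I K (@cell X I @` admissible S) cX hX HK.
- move=> KG; apply: nsK; apply: (small_le ideal KG).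
  apply: small_image => //.
  apply: (@small_sub _ ideal _ _ [set f |
      f `<=` [set l | (E `|` fst @` S) l.1] /\ finite_set f]).
    by move=> f [ff fE _ _]; split => // l fl; apply: fE; exists l.
  by apply: small_finite_subset => //; exact: small_literals.
- exists (@cell X I set0); exists set0 => //; split => //.
  + by rewrite /supp image_set0.
  + by rewrite set0U.
  + by move=> v g [].
- move=> _ [f adf <-]; split; last exact: Scell.
  by apply: cell_open; [case: adf|move=> v; exact: dsep].
have [t Kt nt] : exists2 t, K t & ~ (fst @` (E `|` fst @` S)) t.
  apply: contrapT => nex; apply: nsK.
  apply: (@small_sub _ ideal _ _ (fst @` (E `|` fst @` S))).
    by move=> t Kt; apply: contrapT => nt; apply: nex; exists t.
  exact: small_image.
pose v : V := (t, (B, A1)).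
have nv : ~ (E `|` fst @` S) v by move=> Ev; apply: nt; exists v.
have ngv : ~ supp g v by move=> gv; apply: nv; case: adg => _ + _ _; apply.
exists v, g; split; first by move=> Sv; apply: nv; right.
have sub f : admissible S f -> supp f `<=` E `|` fst @` (S `|` [set (v, g)]).
  move=> [_ fE _ _] w /fE[|[vg Svg <-]]; first by left.
  by right; exists vg => //; left.
have adm' f : admissible S f -> admissible (S `|` [set (v, g)]) f.
  move=> adf; case: (adf) => ff fE fc fS; split => //; first exact: sub.
  move=> w g' fw [|[? ?]]; first exact: fS.
  by subst w; exfalso; apply: nv; exact: fE.
split.
- by move=> w g' [/Ssep//|[-> _]].
- by move=> w g' [/Sadm[/adm' ? ?]//|[-> ->]]; split => //; exact: adm'.
- move=> w g1 w' g2 [Sw|[-> ->]] [Sw'|[-> ->]] //.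
  + exact: Sinj Sw Sw'.
  + move=> /= e; exfalso; apply: nt; exists w => //.
    by right; exists (w, g1).
  + move=> /= e; exfalso; apply: nt; exists w' => //.
    by right; exists (w', g2).
- move=> w g' [/Sfresh//|[-> _]] [u Eu ut]; apply: nt.
  by exists u => //; left.
- move=> f [ff fE fc fS].
  have [fv|nfv] := pselect (supp f v); last first.
    apply: Scell; split => //; last by move=> w g' fw Sw; apply: fS fw _; left.
    move=> w fw; case: (fE _ fw) => [|[vg [Svg|->] /= e]]; first by left.
      by right; exists vg.
    by exfalso; apply: nfv; rewrite e.
  pose f1 := f `\` [set l | l.1 = v].
  have f1f : f1 `<=` f by move=> l [].
  have nf1v : ~ supp f1 v by move=> [l [_ nl] lv]; exact: nl.
  have adf1 : admissible S f1.
    split.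
    + exact: sub_finite_set ff.
    + move=> w f1w; case: (fE _ (supp_sub f1f f1w)) => [|[vg [Svg|->] /= e]].
      * by left.
      * by right; exists vg.
      * by exfalso; apply: nf1v; rewrite e.
    + by apply: consistent_sub fc; apply: setSU.
    + move=> w g' f1w Sw l g'l; split.
        by apply: fS (supp_sub f1f f1w) _ _ g'l; left.
      move=> /= lv; apply: nv; rewrite -lv.
      by have [[_ + _ _] _] := Sadm _ _ Sw; apply; exists l.
  have gf1 : g `<=` f1.
    move=> l gl; split; first by apply: fS fv _ _ gl; right.
    by move=> /= lv; apply: ngv; exists l.
  have [[x0 [x0f1 x0B]] [x1 [x1f1 x1A]]] :=
    gind _ (ex_intro2 _ _ f1 adf1 erefl) (cell_sub gf1).
  have split_f b x : f (v, b) -> cell f1 x -> side (v, b) x -> cell f x.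
    move=> fvb f1x vx [w c] fl; have [wv|nwv] := pselect (w = v).
      subst w; have [->//|nbc] := eqVneq c b; exfalso.
      apply: (@consistentP _ _ (f `|` h) v b fc); first by left.
      by left; move: fl nbc; case: c; case: b {fvb vx}.
    by apply: f1x; split.
  case: fv => -[w [|]] fvb /= wv; subst w.
  + by exists x1; exact: split_f fvb x1f1 _.
  + by exists x0; exact: split_f fvb x0f1 _.
Qed.

Lemma ex_tower :
  compact [set: X] -> hausdorff_space X -> (forall p : X, card_le_pichar K p) ->
  ~ (K #<= [set: nat]) -> ~ (K #<= E) -> dyadic_above E h ->
  exists2 S, tower S & K #<= fst @` S.
Proof.
move=> cX hX HK Kn KE dE.
have [|S [tS _ Smax]] := @Zorn_bigcup_above _ tower set0 (tower_set0 dE).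
  exact: tower_bigcup.
exists S => //; apply: contrapT => KS.
have [v [g [nSv /Smax]]] := tower_extend cX hX HK Kn (dyadic_sep dE)
  (dyadic_consistent dE) KE KS tS.
move=> SS; apply: nSv; exists (v, g) => //; apply: SS; last by right.
by move=> ?; left.
Qed.

End tower.

(** * Delta-systems *)

Lemma card_setD1_II T (A : set T) n x : A #= `I_n.+1 -> A x -> A `\ x #= `I_n.
Proof.
move=> An Ax.
have /finite_setP[m Am] : finite_set (A `\ x).
  by apply: finite_setD; exists n.+1.
have : A #= `I_m.+1 by apply/eq_cardSP; exists x.
by rewrite (card_eql An) => /card_eq_II[->].
Qed.

Section delta_system.
Variables (small : forall J : Type, set J -> Prop) (ideal : card_ideal small).
Variable V : Type.

(** Pigeonhole reduces to sets of one size [n], followed by induction on [n]. A point common to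
    non-small many [g v] joins the root and is removed from them; if there is none, the empty root
    works. *)
Lemma delta_root L (D : set V) (g : V -> set L) :
  ~ small D -> (forall v, D v -> finite_set (g v)) ->
  exists r D', [/\ finite_set r, D' `<=` D, ~ small D',
    forall v, D' v -> r `<=` g v &
    forall l, ~ r l -> small [set v | D' v /\ g v l]].
Proof.
move=> nD gf.
have [n nDn] : exists n, ~ small [set v | D v /\ g v #= `I_n].
  apply: contrapT => nex; apply: nD.
  apply: (@small_sub _ ideal _ _ (\bigcup_n [set v | D v /\ g v #= `I_n])).
    by move=> v Dv; have /finite_setP[n gn] := gf _ Dv; exists n.
  apply: (small_bigcup ideal); first exact: small_nat.
  by move=> n _; apply: contrapT => ?; apply: nex; exists n.
suff [r [D' [rf D'D nD' rg D's]]] : exists r D', [/\ finite_set r,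
    D' `<=` [set v | D v /\ g v #= `I_n], ~ small D',
    forall v, D' v -> r `<=` g v &
    forall l, ~ r l -> small [set v | D' v /\ g v l]].
  by exists r, D'; split => // v /D'D[].
have : forall v, [set v | D v /\ g v #= `I_n] v -> g v #= `I_n by move=> v [].
move: [set v | D v /\ g v #= `I_n] nDn => {D nD gf} D.
elim: n g D => [|n IH] g D nD gn.
  exists set0, D; split;
    [exact: finite_set0|exact: subset_refl|exact: nD|by move=> v _ l|move=> l _].
  apply: (small_finite ideal); suff -> : [set v | D v /\ g v l] = set0 by exact: finite_set0.
  apply/seteqP; split => // v [/gn]; rewrite II0 card_eq0 => /eqP ->//.
have [sD|] := pselect (forall l, small [set v | D v /\ g v l]).
  exists set0, D; split;
    [exact: finite_set0|exact: subset_refl|exact: nD|by move=> v _ l|by []].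
move=> /existsNP[l0 nl0].
have [|r [D' [rf D'D nD' rg D's]]] := IH (fun v => g v `\ l0) _ nl0.
  by move=> v [/gn gvn gvl0]; exact: card_setD1_II.
exists (r `|` [set l0]), D'; split => //.
- by rewrite finite_setU; split.
- by move=> v /D'D[].
- by move=> v D'v l [/(rg _ D'v)[]//|->]; case: (D'D _ D'v).
- move=> l /not_orP[nrl nll0].
  apply: (small_sub ideal) (D's _ nrl) => v [D'v gvl].
  by split => //; split.
Qed.

(** Take a maximal [A] with the required separation. If [A] were small, so would be the set [Z] of
    pairs it involves; as a literal outside the root lies in few [g v], some [v] would avoid [Z] and
    could be added. Separating pairs rather than literals prevents two petals from choosing opposite
    sides. *)
Lemma delta_system (D E : set V) (g : V -> set (V * bool)) :
  ~ small D -> small E -> (forall v, D v -> finite_set (g v)) ->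
  exists r D', [/\ D' `<=` D, ~ small D', forall v, D' v -> r `<=` g v,
    forall v l, D' v -> (g v `\` r) l -> ~ E l.1 &
    forall v w, D' v -> D' w -> v <> w ->
      (forall l, g w l -> l.1 <> v) /\
      (forall l l', (g v `\` r) l -> (g w `\` r) l' -> l.1 <> l'.1)].
Proof.
move=> nD sE gf.
have [r [D1 [rf D1D nD1 rg D1s]]] := delta_root nD gf.
pose P := [set A : set V | [/\ A `<=` D1, forall v, A v -> ~ (fst @` r) v,
    forall v l, A v -> (g v `\` r) l -> ~ E l.1 &
    forall v w, A v -> A w -> v <> w ->
      (forall l, g w l -> l.1 <> v) /\
      (forall l l', (g v `\` r) l -> (g w `\` r) l' -> l.1 <> l'.1)]].
have [||A [[AD1 Ar AE Aind] _ Amax]] := @Zorn_bigcup_above _ P set0.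
- by split.
- move=> F _ FP Ftot; split.
  + by move=> v [A /FP[AD _ _ _] Av]; exact: AD.
  + by move=> v [A /FP[_ Ar _ _] Av]; exact: Ar.
  + by move=> v l [A /FP[_ _ AE _] Av]; exact: AE.
  + move=> v w [A FA Av] [B FB Bw].
    have [AB|BA] := Ftot _ _ FA FB.
      by have [_ _ _] := FP _ FB; apply => //; exact: AB.
    by have [_ _ _] := FP _ FA; apply => //; exact: BA.
exists r, A; split => //.
- by move=> v /AD1/D1D.
- move=> sA.
  pose Z := E `|` (A `|` (fst @` r `|` \bigcup_(v in A) (fst @` g v))).
  have sZ : small Z.
    do 3 apply: small_setU => //.
      by apply: small_finite => //; exact: finite_image.
    apply: (small_bigcup ideal) => // v Av.
    by apply: small_finite => //; apply/finite_image/gf/D1D/AD1.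
  have [v [D1v nZv vZ]] : exists v, [/\ D1 v, ~ Z v &
      forall l, (g v `\` r) l -> ~ Z l.1].
    apply: contrapT => nex; apply: nD1.
    apply: (@small_sub _ ideal _ _ (Z `|`
        \bigcup_(l in [set l | Z l.1 /\ ~ r l]) [set v | D1 v /\ g v l])).
      move=> v D1v; have [|nZv] := pselect (Z v); first by left.
      right; apply: contrapT => nv; apply: nex; exists v; split => //.
      by move=> l [gvl nrl] Zl; apply: nv; exists l.
    apply: small_setU => //; apply: (small_bigcup ideal); last first.
      by move=> l [_ /D1s].
    by apply: (small_sub ideal) (small_literals ideal sZ) => l [].
  have Zr l : r l -> Z l.1 by move=> rl; right; right; left; exists l.
  have ZA w : A w -> Z w by move=> Aw; right; left.
  have Zg w l : A w -> g w l -> Z l.1.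
    by move=> Aw gwl; right; right; right; exists w => //; exists l.
  apply: (nZv); apply: (ZA); apply: (Amax (A `|` [set v])); [|by left|by right].
  split.
  + by move=> w [/AD1//|->].
  + by move=> w [/Ar//|->] [l rl lv]; apply: nZv; rewrite -lv; exact: Zr.
  + move=> w l [Aw|->]; first exact: AE.
    by move=> /vZ nZ El; apply: nZ; left.
  + move=> a b [Aa|->] [Ab|->] nab; [exact: Aind| | |by []].
    * split.
        move=> l gvl la; have [rl|nrl] := pselect (r l).
          by apply: (Ar _ Aa); exists l.
        by apply: (vZ l) => //; rewrite la; exact: ZA.
      move=> l l' [gal _] /vZ nZ e; apply: nZ; rewrite -e.
      exact: Zg gal.
    * split.
        by move=> l gbl lv; apply: nZv; rewrite -lv; exact: Zg gbl.
      move=> l l' /vZ nZ [gbl _] e; apply: nZ; rewrite e.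
      exact: Zg gbl.
- by move=> v /AD1/rg.
Qed.

End delta_system.

(* Take a tower over [E] of size at least [K], thin it out to a Delta-system
   of constraints [g], and shrink the pair [v] to the cell of [g v]: then only
   the part of the root that lives on [E] remains as a constraint. *)
Lemma dyadic_extend (X : topologicalType) (I : Type) (K : set I)
    (small : forall J : Type, set J -> Prop)
    (E : set (I * (set X * set X))) (h : set (I * (set X * set X) * bool)) :
  compact [set: X] -> hausdorff_space X -> (forall p : X, card_le_pichar K p) ->
  ~ (K #<= [set: nat]) -> card_ideal small -> ~ small _ K -> small _ E ->
  dyadic_above E h ->
  exists E' r, [/\ E `<=` E', finite_set r, ~ small _ E' &
    dyadic_above E' (h `|` r)].
Proof.
move=> cX hX HK Kn ideal nsK sE dE.
have KE : ~ (K #<= E) by move=> KE; apply: nsK; exact: small_le KE sE.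
have [S tS KS] := ex_tower cX hX HK Kn KE dE.
have [Ssep Sadm Sinj Sfresh Scell] := tS.
have [Esep hc hE _] := dE.
pose D := fst @` S.
have ex v : exists g, D v -> S (v, g).
  have [[[w g] Sw <-]|] := pselect (D v); first by exists g.
  by exists set0.
have [g Hg] := choice ex.
have gD v g' : S (v, g') -> g' = g v.
  move=> Sv; have Dv : D v by exists (v, g').
  by have [] := Sinj _ _ _ _ Sv (Hg _ Dv) erefl.
have DNE v : D v -> ~ E v.
  by move=> /Hg/Sfresh nE Ev; apply: nE; exists v.
have nsD : ~ small _ D by move=> sD; apply: nsK; exact: small_le KS sD.
have gadm v : D v -> admissible E h S (g v) by move=> /Hg/Sadm[].
have [|r [T [TD nsT rg gE gind]]] := delta_system ideal nsD sE (g := g).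
  by move=> v /gadm[].
(* The tag is unchanged, so the shrunk pairs remain distinct and outside [E]. *)
pose phi v : I * (set X * set X) :=
  (v.1, (v.2.1 `&` cell (g v), v.2.2 `&` cell (g v))).
have phi_side v b : side (phi v, b) = side (v, b) `&` cell (g v) by case: b.
have phiNE v : T v -> ~ E (phi v).
  move=> /TD/Hg/Sfresh nE Ev; apply: nE.
  by exists (phi v).
have phi_inj v w : T v -> T w -> phi v = phi w -> v = w.
  move=> /TD/Hg Sv /TD/Hg Sw [e _ _].
  by have [] := Sinj _ _ _ _ Sv Sw e.
pose rE := r `&` [set l | E l.1].
have [v0 Tv0] : T !=set0.
  apply/set0P/negP => /eqP T0; apply: nsT; rewrite T0.
  by apply: small_finite => //; exact: finite_set0.
have rf : finite_set r.
  by apply: sub_finite_set (rg _ Tv0) _; have [] := gadm _ (TD _ Tv0).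
exists (E `|` phi @` T), rE; split.
- by move=> v; left.
- exact: finite_setIl.
- move=> sE'; apply: nsT; apply: (small_le ideal) sE'.
  apply: (@card_le_trans _ _ _ (phi @` T)); last first.
    by apply: subset_card_le => v; right.
  have := @inj_card_eq _ _ T phi.
  rewrite card_eq_le => /(_ _)/andP[]// v w /set_mem Tv /set_mem Tw.
  exact: phi_inj.
split.
- move=> v [/Esep//|[w /TD Dw <-]].
  have [uo vo d12] := Ssep _ _ (Hg _ Dw).
  have og : open (cell (g w)).
    have [gf gES _ _] := gadm _ Dw.
    by apply: cell_open => // u /gES[/Esep//|[[u' g'] Su <-]]; exact: Ssep Su.
  split; [exact: openI|exact: openI|].
  apply/seteqP; split => // x [/closureI[x1 _] /closureI[x2 _]].
  by rewrite -d12; split.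
- move=> v; have [_ _ gc _] := gadm _ (TD _ Tv0).
  have sub : h `|` rE `<=` g v0 `|` h.
    by move=> l [|[/(rg _ Tv0)]]; [right|left].
  exact: (consistent_sub sub gc).
- by move=> _ [l [hl|[_ El]] <-]; left => //; apply: hE; exists l.
move=> f ff fE' fc.
pose fT := [set l | T l.1 /\ f (phi l.1, l.2)].
have fTf : finite_set fT.
  have inj : {in fT &, injective (fun l => (phi l.1, l.2))}.
    move=> [v b] [w c] /set_mem[/= Tv _] /set_mem[/= Tw _] [e1 e2 e3 ->].
    by rewrite (phi_inj v w)// /phi e1 e2 e3.
  rewrite -(eq_finite_set (inj_card_eq inj)).
  by apply: sub_finite_set ff => _ [l [_ fl] <-].
have suppT v : supp fT v -> T v by move=> [l [Tl _] <-].
(* [fh] undoes the shrinking: it keeps the literals on [E], makes the same choices for the original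
   pairs and adds the constraints of those pairs. Its cell lies in that of [f]. *)
pose fh := (f `&` [set l | E l.1]) `|` fT `|` \bigcup_(v in supp fT) g v.
have fc0 : consistent f by apply: consistent_sub fc => l; left.
have fhc : consistent (fh `|` h).
  (* On [E], petals are absent, so a clash would already occur within [f], [h] and [rE]. On [D], a
     pair of [T] lies in no constraint of a member of [T], its own included, and two constraints
     share pairs only through the root, where they agree. *)
  suff key : forall v b, (fh `|` h) (v, b) -> (fh `|` h) (v, ~~ b) ->
      E v \/ D v -> False.
    move=> u h1 h2; apply: (key u true) => //.
    case: h1 => [[[[_ Ev]|[Tv _]]|[w fw gv]]|hv].
    + by left.
    + by right; exact: TD.
    + have [_ gES _ _] := gadm _ (TD _ (suppT _ fw)).
      by apply: gES; exists (u, true).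
    + by left; apply: hE; exists (u, true).
  have gr w : T w -> forall v b, E v -> g w (v, b) -> rE (v, b).
    move=> Tw v b Ev gv; split => //; apply: contrapT => nr.
    exact: (gE w (v, b)).
  have onE v b : (fh `|` h) (v, b) -> E v -> (f `|` (h `|` rE)) (v, b).
    move=> [[[[fv _]|[/TD/DNE//]]|[w fw gv]]|hv] Ev.
    + by left.
    + by right; right; exact: gr (suppT _ fw) _ _ Ev gv.
    + by right; left.
  have onD v b : (fh `|` h) (v, b) -> D v ->
      fT (v, b) \/ exists2 w, supp fT w & g w (v, b).
    move=> [[[[_ /= Ev]|fTv]|[w fw gv]]|hv] Dv.
    + by case: (DNE _ Dv).
    + by left.
    + by right; exists w.
    + by case: (DNE _ Dv); apply: hE; exists (v, b).
  have TNg v w b c : fT (v, b) -> supp fT w -> g w (v, c) -> False.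
    move=> [/= Tv _] /suppT Tw gv; have [vw|nvw] := pselect (v = w).
      have [_] := Sadm _ _ (Hg _ (TD _ Tw)); apply.
      by exists (v, c) => //; rewrite -vw.
    by have [+ _] := gind _ _ Tv Tw nvw => /(_ _ gv).
  have gcons w : T w -> consistent (g w).
    move=> /TD/gadm[_ _ gc _]; apply: consistent_sub gc => l; by left.
  move=> v b h1 h2 [Ev|Dv].
    exact: (@consistentP _ _ _ v b fc (onE _ _ h1 Ev) (onE _ _ h2 Ev)).
  case: (onD _ _ h1 Dv) (onD _ _ h2 Dv) => [f1|[w fw gw]] [f2|[w' fw' gw']].
  + case: f1 f2 => [_ /= f1] [_ /= f2].
    exact: (consistentP fc0 f1 f2).
  + exact: TNg f1 fw' gw'.
  + exact: TNg f2 fw gw.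
  + have Tw := suppT _ fw; have Tw' := suppT _ fw'.
    have [rb|nrb] := pselect (r (v, b)).
      by apply: (consistentP (gcons _ Tw') (rg _ Tw' _ rb) gw').
    have [rb'|nrb'] := pselect (r (v, ~~ b)).
      by apply: (consistentP (gcons _ Tw) gw (rg _ Tw _ rb')).
    have [ww'|nww'] := pselect (w = w').
      by apply: (consistentP (gcons _ Tw) gw); rewrite ww'.
    by have [_ /(_ (v, b) (v, ~~ b))] := gind _ _ Tw Tw' nww'; apply.
have [x fhx] : cell fh !=set0.
  apply: Scell; split => //.
  - rewrite !finite_setU; split; first by split => //; exact: finite_setIl.
    apply: bigcup_finite; first exact: finite_image.
    by move=> v /suppT/TD/gadm[].
  - move=> _ [l [[[_ El]|[Tl _]]|[w /suppT/TD/gadm[_ gES _ _] gl]] <-].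
    + by left.
    + by right; exact: TD.
    + by apply: gES; exists l.
  - move=> v g' [l fhl lv] Sv l' g'l'; subst v.
    have Dl : D l.1 by exists (l.1, g').
    case: fhl => [[[_ El]|fTl]|[w fw gl]].
    + by case: (DNE _ Dl).
    + by right; exists l.1; [exists l|rewrite -(gD _ _ Sv)].
    + have [_ _ _ gS] := gadm _ (TD _ (suppT _ fw)).
      by right; exists w => //; apply: (gS l.1 g') => //; exists l.
exists x => -[v b] fv.
have [Ev|[w Tw wv]] : (E `|` phi @` T) v by apply: fE'; exists (v, b).
  by apply: fhx; left; left.
have fTw : fT (w, b) by split => //=; rewrite wv.
rewrite -wv phi_side; split; first by apply: fhx; left; right.
by apply: cell_sub fhx => l gl; right; exists w => //; exists (w, b).
Qed.

(** * Families of full size *)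

Section full_size.
Variables (X : topologicalType) (I : Type) (K : set I).
Hypotheses (cX : compact [set: X]) (hX : hausdorff_space X).
Hypotheses (HK : forall p : X, card_le_pichar K p) (X0 : [set: X] !=set0).
Hypothesis Kn : ~ (K #<= [set: nat]).
Let V := (I * (set X * set X))%type.

Lemma dyadic_above_set0 : dyadic_above (set0 : set V) set0.
Proof.
split => //; first by move=> v [l].
move=> f _ f0 _; have [x _] := X0; exists x => l fl.
by exfalso; apply: (f0 l.1); exists l.
Qed.

Lemma not_card_le_countable J (A : set J) : countable A -> ~ (K #<= A).
Proof. by move=> Ac KA; apply: Kn; exact: card_le_trans KA Ac. Qed.

(** Regularity makes the sets not above [K] an ideal, so a single extension of the empty family is
    already large enough. *)
Lemma ex_dyadic_regular :
  (forall (J J' : Type) (D : set J) (F : J -> set J'), ~ (K #<= D) ->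
    (forall i, D i -> ~ (K #<= F i)) -> ~ (K #<= \bigcup_(i in D) F i)) ->
  exists (E : set V) h, [/\ dyadic_above E h, K #<= E & ~ (K #<= supp h)].
Proof.
move=> Kreg; pose small (J : Type) (A : set J) := ~ (K #<= A).
have ideal : card_ideal small.
  by split => // J J' A B AB KB KA; apply: KB; exact: card_le_trans AB.
have [||E [r [_ rf nsE dE]]] := @dyadic_extend X I K small set0 set0
    cX hX HK Kn ideal _ _ dyadic_above_set0.
- by apply; exact: card_lexx.
- by apply: not_card_le_countable; exact: countable0.
exists E, (set0 `|` r); split => //; first exact: contrapT.
apply: not_card_le_countable; apply: finite_set_countable.
by apply: finite_image; rewrite set0U.
Qed.

(* A union of fewer than [K] pieces [F m], each smaller than [K]: extend once
   for each [m], assigning finitely many pairs each time, so that all the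
   assigned pairs together still number fewer than [K].  A token [inl v] puts
   [v] into the family, and [inr (m, q)] records that step [m] assigned [q]. *)
Lemma ex_dyadic_singular (J J' : Type) (M : set J) (F : J -> set J') :
  ~ (K #<= M) -> (forall m, M m -> ~ (K #<= F m)) ->
  K #<= \bigcup_(m in M) F m ->
  exists (E : set V) h, [/\ dyadic_above E h, K #<= E & ~ (K #<= supp h)].
Proof.
move=> KM KF KMF.
pose token := (V + J * set (V * bool))%type.
pose fam (S : set token) := [set v | S (inl v)].
pose asg (S : set token) := [set l | exists m q, S (inr (m, q)) /\ q l].
pose P := [set S : set token | [/\ dyadic_above (fam S) (asg S),
  forall m q, S (inr (m, q)) -> [/\ M m, finite_set q & F m #<= fam S] &
  forall m q q', S (inr (m, q)) -> S (inr (m, q')) -> q = q']].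
have fam_sub S S' : S `<=` S' -> fam S `<=` fam S' by move=> SS' v; exact: SS'.
have asg_sub S S' : S `<=` S' -> asg S `<=` asg S'.
  by move=> SS' l [m [q [Smq ql]]]; exists m, q; split => //; exact: SS'.
have [||S [[dS SM Sfun] _ Smax]] := @Zorn_bigcup_above _ P set0.
- split => //; have -> : fam set0 = set0 by [].
  suff -> : asg set0 = set0 by exact: dyadic_above_set0.
  by apply/seteqP; split => // l [m [q []]].
- move=> C C0 CP Ctot; split; first split.
  + by move=> v [S CS Sv]; have [[+ _ _ _] _ _] := CP _ CS; apply.
  + move=> v [m [q [[S CS Sq] qv]]] [m' [q' [[S' CS' Sq'] qv']]].
    have [SS'|SS'] := Ctot _ _ CS CS'.
      have [[_ + _ _] _ _] := CP _ CS' => /(_ v); apply.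
        by exists m, q; split => //; exact: SS'.
      by exists m', q'.
    have [[_ + _ _] _ _] := CP _ CS => /(_ v); apply.
      by exists m, q.
    by exists m', q'; split => //; exact: SS'.
  + move=> _ [l [m [q [[S CS Sq] ql]]] <-]; exists S => //.
    have [[_ _ + _] _ _] := CP _ CS; apply; exists l => //.
    by exists m, q.
  + move=> f ff fE fc.
    (* Only tokens [inl v] bear on the support of [f]; the others are sent to [None], outside the
       image of [some]. *)
    have [||S CS fS] := @chain_finite_sub _ _ C
        (fun t : token => if t is inl v then Some v else None) set0
        (some @` supp f) C0 Ctot.
    * by do 2 apply: finite_image.
    * move=> _ [v /fE[S CS Sv] <-]; right; exists (inl v) => //.
      by exists S.
    have [[_ _ _ +] _ _] := CP _ CS; apply => //.
      move=> v fv; case: (fS (Some v)); first by exists v.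
        by [].
      by move=> [[w Sw [<-]|//]].
    apply: consistent_sub fc; apply: setUS; apply: asg_sub.
    by move=> t St; exists S.
  + move=> m q [S CS Sq]; have [_ /(_ _ _ Sq)[Mm qf FS] _] := CP _ CS.
    split => //; apply: card_le_trans FS _; apply: subset_card_le; apply: fam_sub.
    by move=> t St; exists S.
  + move=> m q q' [S CS Sq] [S' CS' Sq'].
    have [SS'|SS'] := Ctot _ _ CS CS'.
      by have [_ _ +] := CP _ CS'; apply; [exact: SS' Sq|].
    by have [_ _ +] := CP _ CS; apply; [exact: Sq|exact: SS'].
exists (fam S), (asg S); split => //; last first.
  have [small [ideal sM _ nsK]] := card_nle_ideal Kn KM KM.
  move=> Kh; apply: nsK; apply: (small_le ideal Kh); apply: small_image => //.
  apply: (@small_sub _ ideal _ _ (\bigcup_(m in M)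
      [set l | exists q, S (inr (m, q)) /\ q l])).
    move=> l [m [q [Sq ql]]]; exists m; last by exists q.
    by have [] := SM _ _ Sq.
  apply: (small_bigcup ideal) => // m _; apply: small_finite => //.
  have [[q Sq]|nq] := pselect (exists q, S (inr (m, q))).
    have [_ qf _] := SM _ _ Sq; apply: sub_finite_set qf => l [q' [Sq' q'l]].
    by rewrite (Sfun _ _ _ Sq Sq').
  suff -> : [set l | exists q, S (inr (m, q)) /\ q l] = set0 by [].
  by apply/seteqP; split => // l [q [Sq _]]; apply: nq; exists q.
apply: contrapT => KS.
(* If every [m] had been treated, each [F m] would embed in [fam S], and their union would be too
   small to contain a copy of [K]. *)
have [m Mm nm] : exists2 m, M m & forall q, ~ S (inr (m, q)).
  apply: contrapT => nex.
  have [small [ideal sM sS nsK]] := card_nle_ideal Kn KM KS.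
  apply: nsK; apply: (small_le ideal KMF); apply: (small_bigcup ideal) => // m Mm.
  apply: (@small_le _ ideal _ _ _ (fam S)) => //.
  apply: contrapT => nFm; apply: nex; exists m => // q Sq.
  by apply: nFm; have [] := SM _ _ Sq.
(* With [F m] in the ideal as well, the extension, not being small, is at least as large as
   [F m]. *)
have [small [ideal sS sFm nsK]] := card_nle_ideal Kn KS (KF _ Mm).
have [E [r [SE rf nsE dE]]] := dyadic_extend cX hX HK Kn ideal nsK sS dS.
have FmE : F m #<= E.
  have [//|EFm] := card_le_total (F m) E.
  by exfalso; apply: nsE; exact: small_le EFm sFm.
pose S' := S `|` inl @` E `|` [set inr (m, r)].
apply: (nm r); apply: (Smax S'); [|by move=> ?; left; left|by right].
have famS' : fam S' = E.
  apply/seteqP; split; last by move=> v Ev; left; right; exists v.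
  by move=> v [[/SE//|[w Ew [<-]//]]|].
have asgS' : asg S' = asg S `|` r.
  apply/seteqP; split.
    move=> l [m' [q [[[Sq|[]//]|[_ ->]] ql]]]; last by right.
    by left; exists m', q.
  move=> l [[m' [q [Sq ql]]]|rl].
    by exists m', q; split => //; left; left.
  by exists m, r; split => //; right.
split; first by rewrite famS' asgS'.
- move=> m' q; rewrite famS' => -[[Sq|[]//]|[-> ->]]; last by split.
  have [Mm' qf FS] := SM _ _ Sq; split => //; apply: card_le_trans FS _.
  exact: subset_card_le.
- move=> m' q q' [[Sq|[]//]|[e1 e2]] [[Sq'|[]//]|[e3 e4]].
  + exact: Sfun Sq Sq'.
  + by exfalso; apply: (nm q); rewrite -e3.
  + by exfalso; apply: (nm q'); rewrite -e1.
  + by rewrite e2 e4.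
Qed.

(** A failure of regularity supplies the data of the singular case. In both cases fewer than [K]
    pairs are assigned by [h]; once they are discarded, a consistent choice on the others cannot
    clash with [h]. *)
Lemma ex_dyadic : exists2 F : set V, K #<= F & dyadic_above F set0.
Proof.
have [E [h [[Esep hc hE Ecell] KE Kh]]] : exists (E : set V) h,
    [/\ dyadic_above E h, K #<= E & ~ (K #<= supp h)].
  have [|nreg] := pselect (forall (J J' : Type) (D : set J) (F : J -> set J'),
      ~ (K #<= D) -> (forall i, D i -> ~ (K #<= F i)) ->
      ~ (K #<= \bigcup_(i in D) F i)); first exact: ex_dyadic_regular.
  apply: contrapT => nE; apply: nreg => J J' D F KD KF KDF; apply: nE.
  exact: ex_dyadic_singular KD KF KDF.
exists (E `\` supp h).
  apply: contrapT => KF; have [small [ideal sF sh nsK]] := card_nle_ideal Kn KF Kh.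
  apply: nsK; apply: (small_le ideal KE).
  apply: (@small_sub _ ideal _ _ ((E `\` supp h) `|` supp h)).
    by move=> v Ev; have [|] := pselect (supp h v); [right|left].
  exact: small_setU.
split => //.
- by move=> v [/Esep].
- by move=> v [l].
move=> f ff fE; rewrite setU0 => fc; apply: Ecell => //.
  by move=> v /fE[].
move=> v [fv|hv] [fv'|hv'].
- exact: (fc v).
- by have [|_] := fE v; [exists (v, true)|apply; exists (v, false)].
- by have [|_] := fE v; [exists (v, false)|apply; exists (v, true)].
- exact: (hc v).
Qed.

End full_size.

Theorem theorem5p2 (X : topologicalType) (I : Type) (kappa : set I) :
  compact [set: X] -> hausdorff_space X ->
  ~ (kappa #<= [set: nat]) ->
  @is_min_pichar X I kappa ->
  exists (p : X) (U : set (set X)), @local_splitter X I nat kappa [set: nat] p U.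
Proof.
move=> cX hX Kn [HK [p _]].
have [|F KF dF] := @ex_dyadic X I kappa cX hX HK _ Kn; first by exists p.
exact: dyadic_local_splitter cX KF dF.
Qed.
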